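(* Let $t>0$, $p>0$, $u>-1$, $\mu>0$. If $p-u\le\frac12$, then $$\left|\frac{1}{\mu(p^2+t^2)^{\mu}}-S_{\mu}(t,u)\right|<\frac{1}{\mu p^{2\mu}}-S_{\mu}(0,u),$$ and if $p-u\ge1$, then $$\left|\frac{1}{\mu(p^2+t^2)^{\mu}}-S_{\mu}(t,u)\right|<S_{\mu}(0,u)-\frac{1}{\mu p^{2\mu}}.$$
   Context: For $\mu>0$, $t\in\mathbb{R}$, $u>-1$: $S_{\mu}(t,u):=\sum_{k=1}^{\infty}\frac{2(k+u)}{((k+u)^2+t^2)^{\mu+1}}$. *)

(* Defs.v *)
(* Stdlib reals with Coquelicot. *)
From Stdlib Require Import Reals.
From Coquelicot Require Import Coquelicot.
Open Scope R_scope.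

(* S_mu(t,u).  [Series] is indexed from 0, so the index k >= 1 of the sum is
   [INR (S n)].  The series converges and all bases of [Rpower] are positive
   for mu > 0, u > -1; outside that range the value is not meaningful. *)
Definition S_sum (mu t u : R) : R :=
  Series (fun n : nat =>
    2 * (INR (S n) + u) / Rpower ((INR (S n) + u) ^ 2 + t ^ 2) (mu + 1)).

(* Main.v *)
Require Import Defs.
From Stdlib Require Import Reals Lra ssreflect.
From Coquelicot Require Import Coquelicot.
Open Scope R_scope.

(** Put [F_t(x) = 2 x / (x^2 + t^2)^(mu+1)] and
    [G_t(x) = 1 / (mu (x^2 + t^2)^mu)], so that [G_t' = - F_t], [G_t] vanishes
    at infinity, and [S_mu(t,u)] is the sum of [F_t (k+u)] over [k >= 1].
    Splitting the absolute value, both estimates compare [G(p)] with the sum of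
    [F(k+u)] for the pairs [G = G_0 + e G_t], [F = F_0 + e F_t] with [e = 1]
    and [e = -1].

    The key point is that, for [|e| <= 1] and [t > 0], the function [F] is
    positive, strictly decreasing and strictly convex on [x > 0]
    ([kernel_dominated], [kernel_d1_dominated], [kernel_d2_dominated]): the
    first three derivatives of [G_t] are strictly dominated in absolute value by
    those of [G_0].  The third is the delicate one; it rests on the inequality
    [|(2 mu + 1) x^2 - 3 t^2| x^4 <= (2 mu + 1) (x^2 + t^2)^3], visible on
    coefficients once the left side is bounded by the triangle inequality.

    If [p >= u + 1], the rectangle rule for a decreasing function gives
    [G(k+u) - G(k+u+1) < F(k+u)]; these increments telescope to
    [G(u+1) >= G(p)].  If [p <= u + 1/2], the midpoint rule for a convex
    function gives [F(k+u) < G(k+u-1/2) - G(k+u+1/2)]; these increments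
    telescope to [G(u+1/2) <= G(p)]. *)

(** * Quadrature inequalities for a primitive *)

Lemma lt_of_derive_pos (h dh : R -> R) (a b : R) :
  a < b ->
  (forall x, a <= x <= b -> is_derive h x (dh x)) ->
  (forall x, a < x < b -> 0 < dh x) ->
  h a < h b.
Proof.
intros Hab Hd Hpos.
destruct (MVT_cor2 h dh a b Hab) as [c [Hc Hcab]].
{ intros c Hc. apply is_derive_Reals. now apply Hd. }
assert (0 < dh c * (b - a)) by (apply Rmult_lt_0_compat; [now apply Hpos | lra]).
lra.
Qed.

Section Quadrature.

Variables G F F1 F2 : R -> R.
Hypothesis G_derive : forall x, 0 < x -> is_derive G x (- F x).
Hypothesis F_derive : forall x, 0 < x -> is_derive F x (F1 x).
Hypothesis F1_derive : forall x, 0 < x -> is_derive F1 x (F2 x).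
Hypothesis F_pos : forall x, 0 < x -> 0 < F x.
Hypothesis F1_neg : forall x, 0 < x -> F1 x < 0.
Hypothesis F2_pos : forall x, 0 < x -> 0 < F2 x.

Lemma primitive_decr (x y : R) : 0 < x -> x <= y -> G y <= G x.
Proof using G_derive F_pos.
intros Hx [Hxy | <-]; [ | lra].
enough (- G x < - G y) by lra.
apply (lt_of_derive_pos (fun z => - G z) F); [assumption | | ].
- intros z Hz. replace (F z) with (opp (- F z)) by (unfold opp; simpl; ring).
  apply: is_derive_opp. apply G_derive; lra.
- intros z Hz. apply F_pos; lra.
Qed.

Lemma integrand_decr (x y : R) : 0 < x -> x < y -> F y < F x.
Proof using F_derive F1_neg.
intros Hx Hxy.
enough (- F x < - F y) by lra.
apply (lt_of_derive_pos (fun z => - F z) (fun z => - F1 z)); [assumption | | ].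
- intros z Hz. apply: is_derive_opp. apply F_derive; lra.
- intros z Hz. specialize (F1_neg z). lra.
Qed.

Lemma rectangle_rule (x : R) : 0 < x -> F (x + 1) < G x - G (x + 1) < F x.
Proof using G_derive F_derive F1_neg.
intros Hx.
destruct (MVT_cor2 G (fun z => - F z) x (x + 1)) as [c [Hc Hcx]]; [lra | | ].
{ intros c Hc. apply is_derive_Reals, G_derive; lra. }
assert (F c < F x) by (apply integrand_decr; lra).
assert (F (x + 1) < F c) by (apply integrand_decr; lra).
lra.
Qed.

(** The symmetric second difference vanishes at [s = 0] and has derivative
    [F1 (x + s) - F1 (x - s)], positive because [F1] increases. *)
Lemma symmetric_sum_convex (x s : R) :
  0 < s < x -> 0 < F (x - s) + F (x + s) - 2 * F x.
Proof using F_derive F1_derive F2_pos.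
intros Hs.
pose (k := fun r => F (x - r) + F (x + r)).
enough (k 0 < k s) by
  (unfold k in *; rewrite Rminus_0_r Rplus_0_r in H; lra).
apply (lt_of_derive_pos k (fun r => F1 (x + r) - F1 (x - r))); [lra | | ].
- intros r Hr. unfold k.
  assert (Hm := F_derive (x - r) ltac:(lra)).
  assert (Hp := F_derive (x + r) ltac:(lra)).
  auto_derive.
  + split; [now exists (F1 (x - r)) | split; [now exists (F1 (x + r)) | easy]].
  + rewrite (is_derive_unique (fun x0 => F x0) _ _ Hm) (is_derive_unique (fun x0 => F x0) _ _ Hp).
    ring.
- intros r Hr.
  assert (F1 (x - r) < F1 (x + r)); [ | lra].
  apply (lt_of_derive_pos F1 F2); [lra | | ].
  + intros z Hz. apply F1_derive; lra.
  + intros z Hz. apply F2_pos; lra.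
Qed.

(** The midpoint error vanishes for an interval of half-width [s = 0], and its
    derivative in [s] is the symmetric second difference of [F]. *)
Lemma midpoint_rule (x : R) :
  1 / 2 < x -> F x < G (x - 1 / 2) - G (x + 1 / 2).
Proof using G_derive F_derive F1_derive F2_pos.
intros Hx.
pose (h := fun s => G (x - s) - G (x + s) - 2 * s * F x).
enough (h 0 < h (1 / 2)) by
  (unfold h in *; rewrite Rminus_0_r Rplus_0_r in H; lra).
apply (lt_of_derive_pos h (fun s => F (x - s) + F (x + s) - 2 * F x));
  [lra | | ].
- intros s Hs. unfold h.
  assert (Hm := G_derive (x - s) ltac:(lra)).
  assert (Hp := G_derive (x + s) ltac:(lra)).
  auto_derive.
  + split; [now exists (- F (x - s)) | split; [now exists (- F (x + s)) | easy]].
  + rewrite (is_derive_unique (fun x0 => G x0) _ _ Hm) (is_derive_unique (fun x0 => G x0) _ _ Hp).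
    ring.
- intros s Hs. apply symmetric_sum_convex; lra.
Qed.

End Quadrature.

(** * Telescoping series *)

Lemma is_series_telescope (g : nat -> R) :
  is_lim_seq g 0 -> is_series (fun n => g n - g (S n)) (g O).
Proof.
intros Hg.
assert (Hlim : is_lim_seq (sum_n (fun n => g n - g (S n))) (g O)); [ | exact Hlim].
apply is_lim_seq_ext with (fun n => g O - g (S n)).
- induction n as [ | n IH].
  + now rewrite sum_O.
  + rewrite sum_Sn -IH. unfold plus; simpl. ring.
- replace (Finite (g O)) with (Finite (g O - 0)) by (f_equal; ring).
  apply is_lim_seq_minus'; [apply is_lim_seq_const | now apply is_lim_seq_incr_1 in Hg].
Qed.

Lemma Series_lt (a b : nat -> R) :
  (forall n, a n < b n) -> ex_series a -> ex_series b -> Series a < Series b.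
Proof.
intros Hab Ha Hb.
enough (0 < Series (fun n => b n - a n)) by (rewrite Series_minus // in H; lra).
rewrite Series_incr_1; [ | now apply: ex_series_minus].
assert (0 <= Series (fun n => b (S n) - a (S n))).
{ rewrite -(Rmult_0_l (Series (fun n => b (S n) - a (S n)))) -Series_scal_l.
  apply Series_le.
  - intros n. specialize (Hab (S n)). lra.
  - apply (ex_series_incr_1 (fun n => b n - a n)). now apply: ex_series_minus. }
specialize (Hab O). lra.
Qed.

(** * The kernel and its derivatives *)

Definition invpow (a t x : R) : R := / Rpower (x ^ 2 + t ^ 2) a.

Definition primitive (mu t x : R) : R := / mu * invpow mu t x.
Definition kernel (mu t x : R) : R := 2 * x * invpow (mu + 1) t x.
Definition kernel_d1 (mu t x : R) : R :=
  2 * (t ^ 2 - (2 * mu + 1) * x ^ 2) * invpow (mu + 2) t x.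
Definition kernel_d2 (mu t x : R) : R :=
  4 * (mu + 1) * x * ((2 * mu + 1) * x ^ 2 - 3 * t ^ 2) * invpow (mu + 3) t x.

Lemma sq_sum_pos (t x : R) : 0 < x -> 0 < x ^ 2 + t ^ 2.
Proof. intros; nra. Qed.

Lemma invpow_pos (a t x : R) : 0 < invpow a t x.
Proof. apply Rinv_0_lt_compat, exp_pos. Qed.

Lemma invpow_shift (a t x : R) :
  0 < x -> invpow a t x = (x ^ 2 + t ^ 2) * invpow (a + 1) t x.
Proof.
intros Hx. assert (Hq := sq_sum_pos t x Hx). unfold invpow.
rewrite Rpower_plus Rpower_1 //.
assert (0 < Rpower (x ^ 2 + t ^ 2) a) by apply exp_pos.
field. lra.
Qed.

Lemma invpow_lt_0 (a t x : R) :
  0 < a -> 0 < t -> 0 < x -> invpow a t x < invpow a 0 x.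
Proof.
intros Ha Ht Hx. unfold invpow. apply Rinv_lt_contravar.
- apply Rmult_lt_0_compat; apply exp_pos.
- apply Rlt_Rpower_l; nra.
Qed.

Lemma is_derive_invpow (a t x : R) :
  0 < x ->
  is_derive (invpow a t) x (- (2 * a * x) * invpow (a + 1) t x).
Proof.
intros Hx. assert (Hq := sq_sum_pos t x Hx).
assert (Hshift := invpow_shift a t x Hx).
assert (E : invpow (a + 1) t x = invpow a t x / (x ^ 2 + t ^ 2))
  by (rewrite Hshift; field; lra).
rewrite E. unfold invpow, Rpower.
assert (He := exp_pos (a * ln (x ^ 2 + t ^ 2))).
auto_derive.
- split; [lra | split; [ | easy]]. simpl in He. apply Rgt_not_eq. exact He.
- simpl in *. field. lra.
Qed.

Lemma is_derive_primitive (mu t x : R) :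
  0 < mu -> 0 < x -> is_derive (primitive mu t) x (- kernel mu t x).
Proof.
intros Hmu Hx. assert (D := is_derive_invpow mu t x Hx).
unfold primitive. auto_derive.
- now eexists; exact D.
- rewrite (is_derive_unique (fun x => invpow mu t x) _ _ D). unfold kernel. field. lra.
Qed.

Lemma is_derive_kernel (mu t x : R) :
  0 < x -> is_derive (kernel mu t) x (kernel_d1 mu t x).
Proof.
intros Hx. assert (D := is_derive_invpow (mu + 1) t x Hx).
unfold kernel. auto_derive.
- now eexists; exact D.
- rewrite (is_derive_unique (fun x => invpow (mu + 1) t x) _ _ D).
  rewrite (invpow_shift (mu + 1)) //. unfold kernel_d1.
  replace (mu + 1 + 1) with (mu + 2) by ring. ring.
Qed.

Lemma is_derive_kernel_d1 (mu t x : R) :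
  0 < x -> is_derive (kernel_d1 mu t) x (kernel_d2 mu t x).
Proof.
intros Hx. assert (D := is_derive_invpow (mu + 2) t x Hx).
unfold kernel_d1. auto_derive.
- now eexists; exact D.
- rewrite (is_derive_unique (fun x => invpow (mu + 2) t x) _ _ D).
  rewrite (invpow_shift (mu + 2)) //. unfold kernel_d2.
  replace (mu + 2 + 1) with (mu + 3) by ring. ring.
Qed.

(** * Domination by the kernel at [t = 0] *)

Lemma kernel_pos (mu t x : R) : 0 < x -> 0 < kernel mu t x.
Proof.
intros Hx. unfold kernel. assert (H := invpow_pos (mu + 1) t x). nra.
Qed.

Lemma kernel_dominated (mu t x : R) :
  0 < mu -> 0 < t -> 0 < x -> Rabs (kernel mu t x) < kernel mu 0 x.
Proof.
intros Hmu Ht Hx. rewrite Rabs_pos_eq; [ | now apply Rlt_le, kernel_pos].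
apply Rmult_lt_compat_l; [lra | ]. apply invpow_lt_0; lra.
Qed.

(** Both signs of the polynomial factor are absorbed by
    [(2 mu + 1) (x^2 + t^2)], which lowers the exponent by one; what remains
    decreases strictly in [t]. *)
Lemma kernel_d1_dominated (mu t x : R) :
  0 < mu -> 0 < t -> 0 < x -> Rabs (kernel_d1 mu t x) < - kernel_d1 mu 0 x.
Proof.
intros Hmu Ht Hx.
assert (Hlt := invpow_lt_0 (mu + 1) t x ltac:(lra) Ht Hx).
rewrite !(invpow_shift (mu + 1)) // in Hlt.
replace (mu + 1 + 1) with (mu + 2) in Hlt by ring.
assert (HJ := invpow_pos (mu + 2) t x).
unfold kernel_d1. set (J := invpow (mu + 2) t x) in *.
set (J0 := invpow (mu + 2) 0 x) in *.
rewrite Rabs_mult (Rabs_pos_eq J); [ | lra].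
assert (Hpoly : Rabs (2 * (t ^ 2 - (2 * mu + 1) * x ^ 2))
                <= 2 * (2 * mu + 1) * (x ^ 2 + t ^ 2)).
{ assert (0 <= x ^ 2) by nra. assert (0 <= t ^ 2) by nra.
  apply Rabs_le. split; nra. }
apply Rle_lt_trans with (2 * (2 * mu + 1) * (x ^ 2 + t ^ 2) * J).
{ apply Rmult_le_compat_r; lra. }
replace (- (2 * (0 ^ 2 - (2 * mu + 1) * x ^ 2) * J0))
  with (2 * (2 * mu + 1) * ((x ^ 2 + 0 ^ 2) * J0)) by ring.
rewrite Rmult_assoc. apply Rmult_lt_compat_l; lra.
Qed.

(** For [mu < 1] a single factor [x^2 + t^2] does not absorb the term
    [3 t^2].  Three factors do for every [mu > 0], because the expansion of
    [(x^2 + t^2)^3] contains both [x^6] and [3 x^4 t^2]; they lower the exponent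
    to [mu], which is still positive, so that what remains decreases strictly
    in [t]. *)
Lemma kernel_d2_dominated (mu t x : R) :
  0 < mu -> 0 < t -> 0 < x -> Rabs (kernel_d2 mu t x) < kernel_d2 mu 0 x.
Proof.
intros Hmu Ht Hx.
assert (Hlt := invpow_lt_0 mu t x Hmu Ht Hx).
assert (E3 : forall s, invpow mu s x = (x ^ 2 + s ^ 2) ^ 3 * invpow (mu + 3) s x).
{ intros s. rewrite (invpow_shift mu) // (invpow_shift (mu + 1)) //.
  rewrite (invpow_shift (mu + 1 + 1)) //.
  replace (mu + 1 + 1 + 1) with (mu + 3) by ring. ring. }
rewrite !E3 in Hlt.
assert (HJ := invpow_pos (mu + 3) t x).
unfold kernel_d2. set (J := invpow (mu + 3) t x) in *.
set (J0 := invpow (mu + 3) 0 x) in *.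
assert (Hc : 0 < 4 * (mu + 1) * x) by nra.
rewrite 2!Rabs_mult (Rabs_pos_eq J) ?(Rabs_pos_eq (4 * (mu + 1) * x)); try lra.
rewrite 2!(Rmult_assoc (4 * (mu + 1) * x)).
apply Rmult_lt_compat_l; [exact Hc | ].
assert (Hx4 : 0 < x ^ 4) by (apply pow_lt; lra).
assert (0 < t ^ 2) by (apply pow_lt; lra).
assert (0 < x ^ 2) by (apply pow_lt; lra).
(* The factor x^4 makes both polynomial factors homogeneous of degree 6. *)
apply Rmult_lt_reg_l with (x ^ 4); [exact Hx4 | ].
assert (Hpoly : x ^ 4 * Rabs ((2 * mu + 1) * x ^ 2 - 3 * t ^ 2)
                <= (2 * mu + 1) * (x ^ 2 + t ^ 2) ^ 3).
{ apply Rle_trans with (x ^ 4 * ((2 * mu + 1) * (x ^ 2 + 3 * t ^ 2))).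
  - apply Rmult_le_compat_l; [lra | ]. apply Rabs_le. split; nra.
  - replace (x ^ 4 * ((2 * mu + 1) * (x ^ 2 + 3 * t ^ 2)))
      with ((2 * mu + 1) * (x ^ 4 * (x ^ 2 + 3 * t ^ 2))) by ring.
    apply Rmult_le_compat_l; [lra | ].
    assert (0 < x ^ 2 * (t ^ 2) ^ 2) by (apply Rmult_lt_0_compat; nra).
    assert (0 < (t ^ 2) ^ 3) by (apply pow_lt; lra).
    replace (x ^ 4) with ((x ^ 2) ^ 2) by ring. nra. }
apply Rle_lt_trans with ((2 * mu + 1) * (x ^ 2 + t ^ 2) ^ 3 * J).
{ rewrite -Rmult_assoc. apply Rmult_le_compat_r; lra. }
replace (x ^ 4 * (((2 * mu + 1) * x ^ 2 - 3 * 0 ^ 2) * J0))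
  with ((2 * mu + 1) * ((x ^ 2 + 0 ^ 2) ^ 3 * J0)) by ring.
rewrite Rmult_assoc. apply Rmult_lt_compat_l; lra.
Qed.

Lemma add_scaled_pos (e a b : R) : Rabs e <= 1 -> Rabs b < a -> 0 < a + e * b.
Proof.
intros He Hb.
assert (Rabs (e * b) <= Rabs b)
  by (rewrite Rabs_mult; assert (H := Rabs_pos b); nra).
assert (H1 := Rabs_maj2 (e * b)). lra.
Qed.

(** * Convergence of the series *)

Lemma is_lim_seq_primitive (mu t a : R) :
  0 < mu -> 0 < a -> is_lim_seq (fun n => primitive mu t (a + INR n)) 0.
Proof.
intros Hmu Ha.
replace (Finite 0) with (Rbar_mult (/ mu) 0) by (simpl; f_equal; ring).
apply is_lim_seq_scal_l. unfold invpow.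
replace (Finite 0) with (Rbar_inv p_infty) by reflexivity.
apply is_lim_seq_inv; [ | discriminate]. unfold Rpower.
apply (is_lim_comp_seq exp _ p_infty p_infty is_lim_exp_p).
{ now exists O. }
replace p_infty with (Rbar_mult mu p_infty).
2:{ simpl. destruct (Rle_dec 0 mu) as [H | H]; [ | lra].
    destruct (Rle_lt_or_eq_dec 0 mu H); [easy | lra]. }
apply is_lim_seq_scal_l.
apply (is_lim_comp_seq ln _ p_infty p_infty is_lim_ln_p).
{ now exists O. }
apply is_lim_seq_le_p_loc with INR; [ | exact is_lim_seq_INR].
exists 1%nat. intros n Hn.
apply le_INR in Hn. simpl in Hn. nra.
Qed.

Lemma kernel_0_d1_neg (mu x : R) :
  0 < mu -> 0 < x -> kernel_d1 mu 0 x < 0.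
Proof.
intros Hmu Hx.
assert (H := kernel_d1_dominated mu 1 x Hmu Rlt_0_1 Hx).
assert (H' := Rabs_pos (kernel_d1 mu 1 x)). lra.
Qed.

(** The terms after the first are dominated by telescoping increments of the
    primitive; the first must be set aside since its increment would start at
    [a - 1], which need not be positive. *)
Lemma ex_series_kernel_0 (mu a : R) :
  0 < mu -> 0 < a -> ex_series (fun n => kernel mu 0 (a + INR n)).
Proof.
intros Hmu Ha. apply ex_series_incr_1.
apply: (ex_series_le (K := R_AbsRing) (V := R_CompleteNormedModule) _
  (fun n => primitive mu 0 (a + INR n) - primitive mu 0 (a + INR (S n)))).
2:{ eexists. apply is_series_telescope. now apply is_lim_seq_primitive. }
intros n. rewrite S_INR. assert (Hn := pos_INR n).
replace (a + (INR n + 1)) with (a + INR n + 1) by ring.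
unfold norm; simpl; unfold abs; simpl.
rewrite Rabs_pos_eq; [ | apply Rlt_le, kernel_pos; lra].
apply Rlt_le.
apply (rectangle_rule (primitive mu 0) (kernel mu 0) (kernel_d1 mu 0)); [ | | | lra].
- intros x Hx. now apply is_derive_primitive.
- intros x Hx. now apply is_derive_kernel.
- intros x Hx. now apply kernel_0_d1_neg.
Qed.

Lemma ex_series_kernel (mu t a : R) :
  0 < mu -> 0 < t -> 0 < a -> ex_series (fun n => kernel mu t (a + INR n)).
Proof.
intros Hmu Ht Ha.
apply: (ex_series_le (K := R_AbsRing) (V := R_CompleteNormedModule) _
  (fun n => kernel mu 0 (a + INR n))).
2:now apply ex_series_kernel_0.
intros n. assert (Hn := pos_INR n).
apply Rlt_le, kernel_dominated; lra.
Qed.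

(** * The two comparisons *)

Section Combination.

Variables mu t e : R.
Hypothesis mu_pos : 0 < mu.
Hypothesis t_pos : 0 < t.
Hypothesis e_le1 : Rabs e <= 1.

Let G x := primitive mu 0 x + e * primitive mu t x.
Let F x := kernel mu 0 x + e * kernel mu t x.
Let F1 x := kernel_d1 mu 0 x + e * kernel_d1 mu t x.
Let F2 x := kernel_d2 mu 0 x + e * kernel_d2 mu t x.

Lemma is_derive_combination (f g : R -> R) (x df dg : R) :
  is_derive f x df -> is_derive g x dg ->
  is_derive (fun y => f y + e * g y) x (df + e * dg).
Proof using.
intros Hf Hg. apply: is_derive_plus; [exact Hf | ].
now apply is_derive_scal.
Qed.

Lemma comb_G_derive (x : R) : 0 < x -> is_derive G x (- F x).
Proof using mu_pos.
intros Hx. replace (- F x) with (- kernel mu 0 x + e * - kernel mu t x)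
  by (unfold F; ring).
now apply is_derive_combination; apply is_derive_primitive.
Qed.

Lemma comb_F_derive (x : R) : 0 < x -> is_derive F x (F1 x).
Proof using.
intros Hx. now apply is_derive_combination; apply is_derive_kernel.
Qed.

Lemma comb_F1_derive (x : R) : 0 < x -> is_derive F1 x (F2 x).
Proof using.
intros Hx. now apply is_derive_combination; apply is_derive_kernel_d1.
Qed.

Lemma comb_F_pos (x : R) : 0 < x -> 0 < F x.
Proof using mu_pos t_pos e_le1.
intros Hx. apply add_scaled_pos; [assumption | now apply kernel_dominated].
Qed.

Lemma comb_F1_neg (x : R) : 0 < x -> F1 x < 0.
Proof using mu_pos t_pos e_le1.
intros Hx. unfold F1.
enough (0 < - kernel_d1 mu 0 x + e * - kernel_d1 mu t x) by lra.
apply add_scaled_pos; [assumption | ].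
rewrite Rabs_Ropp. now apply kernel_d1_dominated.
Qed.

Lemma comb_F2_pos (x : R) : 0 < x -> 0 < F2 x.
Proof using mu_pos t_pos e_le1.
intros Hx. apply add_scaled_pos; [assumption | now apply kernel_d2_dominated].
Qed.

Lemma comb_telescope (a : R) :
  0 < a -> is_series (fun n => G (a + INR n) - G (a + INR n + 1)) (G a).
Proof using mu_pos.
intros Ha.
replace (G a) with (G (a + INR 0)) by (simpl; now rewrite Rplus_0_r).
apply is_series_ext with (fun n => G (a + INR n) - G (a + INR (S n))).
{ intros n. rewrite S_INR. now rewrite Rplus_assoc. }
apply (is_series_telescope (fun n => G (a + INR n))).
replace (Finite 0) with (Finite (0 + e * 0)) by (f_equal; ring).
apply is_lim_seq_plus'; [now apply is_lim_seq_primitive | ].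
apply (is_lim_seq_scal_l (fun n => primitive mu t (a + INR n)) e 0).
now apply is_lim_seq_primitive.
Qed.

Lemma comb_ex_series (a : R) : 0 < a -> ex_series (fun n => F (a + INR n)).
Proof using mu_pos t_pos.
intros Ha. apply: ex_series_plus; [now apply ex_series_kernel_0 | ].
now apply: ex_series_scal_l; apply ex_series_kernel.
Qed.

(** Midpoint intervals around [1 + u + n] tile the half-line from [u + 1/2],
    which lies in the domain since [u + 1/2 >= p > 0]. *)
Lemma series_lt_primitive (p u : R) :
  0 < p -> p - u <= 1 / 2 -> Series (fun n => F (1 + u + INR n)) < G p.
Proof using mu_pos t_pos e_le1.
intros Hp Hpu.
assert (T := comb_telescope (u + 1 / 2) ltac:(lra)).
apply Rlt_le_trans with (G (u + 1 / 2)).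
2:apply (primitive_decr G F comb_G_derive comb_F_pos); lra.
rewrite -(is_series_unique _ _ T). apply Series_lt.
- intros n. assert (Hn := pos_INR n).
  assert (M := midpoint_rule G F F1 F2 comb_G_derive comb_F_derive
                 comb_F1_derive comb_F2_pos (1 + u + INR n) ltac:(lra)).
  replace (u + 1 / 2 + INR n) with (1 + u + INR n - 1 / 2) by field.
  replace (1 + u + INR n - 1 / 2 + 1) with (1 + u + INR n + 1 / 2) by field.
  exact M.
- apply comb_ex_series; lra.
- now exists (G (u + 1 / 2)).
Qed.

(** The intervals to the right of [1 + u + n] tile the half-line from
    [1 + u]. *)
Lemma primitive_lt_series (p u : R) :
  -1 < u -> 1 <= p - u -> G p < Series (fun n => F (1 + u + INR n)).
Proof using mu_pos t_pos e_le1.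
intros Hu Hpu.
assert (T := comb_telescope (1 + u) ltac:(lra)).
apply Rle_lt_trans with (G (1 + u)).
{ apply (primitive_decr G F comb_G_derive comb_F_pos); lra. }
rewrite -(is_series_unique _ _ T). apply Series_lt.
- intros n. assert (Hn := pos_INR n).
  apply (rectangle_rule G F F1 comb_G_derive comb_F_derive comb_F1_neg); lra.
- now exists (G (1 + u)).
- apply comb_ex_series; lra.
Qed.

End Combination.

Lemma S_sum_kernel (mu t u : R) :
  S_sum mu t u = Series (fun n => kernel mu t (1 + u + INR n)).
Proof.
apply Series_ext. intros n. rewrite S_INR. unfold kernel, invpow.
now replace (1 + u + INR n) with (INR n + 1 + u) by ring.
Qed.

Lemma Series_combination (mu t e u : R) :
  0 < mu -> 0 < t -> -1 < u ->
  Series (fun n => kernel mu 0 (1 + u + INR n) + e * kernel mu t (1 + u + INR n))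
  = S_sum mu 0 u + e * S_sum mu t u.
Proof.
intros Hmu Ht Hu. rewrite !S_sum_kernel -Series_scal_l.
apply Series_plus.
- apply ex_series_kernel_0; lra.
- apply: ex_series_scal_l. apply ex_series_kernel; lra.
Qed.

Lemma primitive_quotient (mu t x : R) :
  0 < mu -> 1 / (mu * Rpower (x ^ 2 + t ^ 2) mu) = primitive mu t x.
Proof.
intros Hmu. unfold primitive, invpow.
assert (H := exp_pos (mu * ln (x ^ 2 + t ^ 2))). fold (Rpower (x ^ 2 + t ^ 2) mu) in H.
field. lra.
Qed.

Lemma Rpower_double (x a : R) : 0 < x -> Rpower x (2 * a) = Rpower (x ^ 2 + 0 ^ 2) a.
Proof.
intros Hx. rewrite -Rpower_mult. f_equal.
replace 2 with (INR 2) at 1 by (simpl; ring). rewrite Rpower_pow //. ring.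
Qed.

Theorem theorem2p7 (t p u mu : R)
  (ht : 0 < t) (hp : 0 < p) (hu : -1 < u) (hmu : 0 < mu) :
  (p - u <= 1 / 2 ->
     Rabs (1 / (mu * Rpower (p ^ 2 + t ^ 2) mu) - S_sum mu t u)
       < 1 / (mu * Rpower p (2 * mu)) - S_sum mu 0 u) /\
  (1 <= p - u ->
     Rabs (1 / (mu * Rpower (p ^ 2 + t ^ 2) mu) - S_sum mu t u)
       < S_sum mu 0 u - 1 / (mu * Rpower p (2 * mu))).
Proof.
rewrite (Rpower_double p) // !primitive_quotient //.
assert (Hplus : Rabs 1 <= 1) by (rewrite Rabs_R1; lra).
assert (Hminus : Rabs (- 1) <= 1) by (rewrite Rabs_Ropp Rabs_R1; lra).
split; intros Hpu; apply Rabs_def1.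
(* An upper bound on the difference is the combination of one sign, the lower
   bound that of the other; the signs swap between the two ranges of p. *)
- assert (H := series_lt_primitive mu t (- 1) hmu ht Hminus p u hp Hpu).
  rewrite Series_combination // in H. lra.
- assert (H := series_lt_primitive mu t 1 hmu ht Hplus p u hp Hpu).
  rewrite Series_combination // in H. lra.
- assert (H := primitive_lt_series mu t 1 hmu ht Hplus p u hu Hpu).
  rewrite Series_combination // in H. lra.
- assert (H := primitive_lt_series mu t (- 1) hmu ht Hminus p u hu Hpu).
  rewrite Series_combination // in H. lra.
Qed.
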